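(* If a Hausdorff topological semigroup $S$ contains the discrete semigroup $\mathbf{ID}_{\infty}$, then its square $S\times S$ is not a countably compact space.
   Context: A partial cofinite isometry of the set of integers $\mathbb{Z}$ is a partial map $\alpha\colon\mathbb{Z}\rightharpoonup\mathbb{Z}$ such that $\mathbb{Z}\setminus\operatorname{dom}\alpha$ and $\mathbb{Z}\setminus\operatorname{ran}\alpha$ are finite and $|(x)\alpha-(y)\alpha|=|x-y|$ for all $x,y\in\operatorname{dom}\alpha$. $\mathbf{ID}_{\infty}$ is the semigroup (an inverse monoid) of all partial cofinite isometries of $\mathbb{Z}$ under composition of partial maps (maps written on the right). A topological semigroup is a topological space with a jointly continuous semigroup operation. ''Contains the discrete semigroup $\mathbf{ID}_{\infty}$'' means that (an isomorphic copy of) $\mathbf{ID}_{\infty}$ is a subsemigroup of $S$ whose subspace topology is discrete. A space is countably compact if each of its countable open covers has a finite subcover. *)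

(* Defs.v *)
From HB Require Import structures.
From mathcomp Require Import all_boot all_order all_algebra.
From mathcomp Require Import all_classical topology.

Set Implicit Arguments.
Unset Strict Implicit.
Unset Printing Implicit Defensive.

Import Order.TTheory GRing.Theory Num.Theory.

Local Open Scope classical_set_scope.
Local Open Scope ring_scope.

(* A partial map from int to int is a function alpha : int -> option int, where
   alpha x = None means that alpha is not defined at x. *)
Definition pdom (alpha : int -> option int) : set int :=
  [set x | exists y, alpha x = Some y].

Definition pran (alpha : int -> option int) : set int :=
  [set y | exists x, alpha x = Some y].

Definition cofinite_isometry (alpha : int -> option int) : Prop :=
  [/\ cofinite_set (pdom alpha), cofinite_set (pran alpha) &
      forall x y x' y', alpha x = Some x' -> alpha y = Some y' ->
        `|x' - y'| = `|x - y|].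

Record ID_infty := IDInfty {
  ID_val :> int -> option int;
  _ : `[< cofinite_isometry ID_val >] }.

HB.instance Definition _ := [isSub for ID_val].
HB.instance Definition _ := [Choice of ID_infty by <:].

Lemma ID_inftyP (alpha : ID_infty) : cofinite_isometry alpha.
Proof. exact/asboolP/(valP alpha). Qed.

Lemma cofinite_isometry_inj alpha x y z : cofinite_isometry alpha ->
  alpha x = Some z -> alpha y = Some z -> x = y.
Proof.
move=> [_ _ iso] ax ay; apply/eqP; rewrite -subr_eq0 -normr_eq0.
by rewrite -(iso _ _ _ _ ax ay) subrr normr0.
Qed.

Lemma cofinite_isometry_comp alpha beta :
  cofinite_isometry alpha -> cofinite_isometry beta ->
  cofinite_isometry (pcomp beta alpha).
Proof.
move=> ca cb; have [da ra ia] := ca; have [db rb ib] := cb; split.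
- apply: (@sub_finite_set _ _
    (~` pdom alpha `|` alpha @^-1` (Some @` (~` pdom beta)))).
    move=> x /= nx; case ax: (alpha x) => [y|]; last by left=> -[z]; rewrite ax.
    right; exists y; rewrite ?ax // => -[z byz].
    by apply: nx; exists z; rewrite /pcomp ax /= byz.
  rewrite finite_setU; split=> //; apply: finite_preimage.
    move=> x y; rewrite !inE /= => -[z _ zx] [t _ ty] xy.
    by apply: (cofinite_isometry_inj ca (z := z)); rewrite -?xy -zx.
  exact: finite_image.
- apply: (@sub_finite_set _ _
    (~` pran beta `|` (odflt 0 \o beta) @` (~` pran alpha))).
    move=> y /= ny; have [[z bzy]|] := pselect (pran beta y); last by left.
    right; exists z; rewrite /= ?bzy // => -[x axz].
    by apply: ny; exists x; rewrite /pcomp axz /= bzy.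
  by rewrite finite_setU; split=> //; exact: finite_image.
- move=> x y x' y'; rewrite /pcomp.
  case ax: (alpha x) => [u|] //=; case ay: (alpha y) => [v|] //= bu bv.
  by rewrite (ib _ _ _ _ bu bv) (ia _ _ _ _ ax ay).
Qed.

(* Maps act on the right: x (alpha beta) = (x alpha) beta. *)
Definition ID_mul (alpha beta : ID_infty) : ID_infty :=
  IDInfty (asboolT
    (cofinite_isometry_comp (ID_inftyP alpha) (ID_inftyP beta))).

Lemma ID_mulA : associative ID_mul.
Proof.
move=> a b c; apply/val_inj/funext => x /=.
by rewrite /pcomp; case: (ID_val a x).
Qed.

HB.instance Definition _ := isSemigroup.Build ID_infty ID_mulA.

#[short(type="preTopologicalSemigroupType")]
HB.structure Definition PreTopologicalSemigroup :=
  {S of Topological S & Semigroup S}.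

HB.mixin Record PreTopologicalSemigroup_isTopologicalSemigroup S
    of PreTopologicalSemigroup S := {
  mulg_continuous : continuous (fun xy : S * S => (xy.1 * xy.2)%g)
}.

#[short(type="topologicalSemigroupType")]
HB.structure Definition TopologicalSemigroup :=
  {S of PreTopologicalSemigroup S &
        PreTopologicalSemigroup_isTopologicalSemigroup S}.

(* The type set_type A carries the subspace topology, whereas in the library's
   [subspace A] the points outside A are made isolated. *)
Definition discrete_subspace (T : topologicalType) (A : set T) : Prop :=
  forall B : set (set_type A), open B.

Definition contains_discrete (G : semigroupType) (S : topologicalSemigroupType)
    : Prop :=
  exists f : {multiplicative G -> S},
    injective f /\ discrete_subspace (range f).

(* The library's [cover_compact], restricted to countable covers. *)
Definition countably_compact (T : topologicalType) (A : set T) : Prop :=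
  forall (I : choiceType) (D : set I) (f : I -> set T),
    countable D -> (forall i, D i -> open (f i)) -> A `<=` cover D f ->
    finite_subset_cover D f A.

(* Main.v *)
Require Import Defs.
From HB Require Import structures.
From mathcomp Require Import all_boot all_order all_algebra.
From mathcomp Require Import finmap.
From mathcomp Require Import all_classical topology.

(** The translations of the integers form an infinite group of units inside
    [ID_infty], and this alone is incompatible with countable compactness of
    the square.  Write t for the translation by 1 and consider the sequence of
    pairs (t^n, t^-n) in S * S.  By countable compactness it has a cluster
    point (a, b) ([countably_compact_cluster]).  All products t^n t^-n equal
    the identity translation 1, so continuity and the Hausdorff property give
    a b = 1.  Discreteness provides a neighbourhood U of 1 in S meeting the copy
    of [ID_infty] only in 1 ([discrete_subspace_nbhs]).  By continuity at (a, b)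
    there are neighbourhoods V of a and W of b with V W contained in U.  As
    (t^n, t^-n) lies in V * W for infinitely many n, pick two such indices
    n < m: the mixed product t^n t^-m = t^(n-m) lies in V W, hence in U, and so
    equals 1, which is absurd ([not_countably_compact_inverse_sequences]). *)

Import GRing.Theory.

Local Open Scope classical_set_scope.

(** Otherwise the complements of the closures of the tails of [u] would form
    an increasing countable open cover, and a finite subcover would miss all
    late enough terms of [u]. *)
Lemma countably_compact_cluster (T : topologicalType) (u : nat -> T) :
  countably_compact [set: T] -> exists p, cluster (u @ \oo) p.
Proof.
move=> cT; apply: contrapT => /forallNP nocl.
pose tail n := u @` [set k | (n <= k)%N].
have [||p _|D' _ cov] := cT nat setT (fun n => ~` closure (tail n)).
- exact: countableP.
- by move=> n _; exact/closed_openC/closed_closure.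
- apply: contrapT => ncov; apply: (nocl p) => A B [N _ NA] pB.
  have : closure (tail N) p by apply: contrapT => pN; apply: ncov; exists N.
  by move=> /(_ B pB) [_ [[k Nk <-] Bk]]; exists (u k); split=> //; exact: NA.
- pose N := (\max_(i <- D') i)%N.
  have [i /= iD' []] := cov (u N) I.
  by apply: subset_closure; exists N => //=; exact: leq_bigmax_seq.
Qed.

Lemma discrete_subspace_nbhs (T : topologicalType) (A : set T) (c : T) :
  discrete_subspace A -> A c ->
  exists2 U : set T, nbhs c U & forall x, A x -> U x -> x = c.
Proof.
move=> dA Ac; have [U Uo UE] := dA [set z | set_val z = c].
exists U => [|x Ax Ux].
  apply: open_nbhs_nbhs; split=> //.
  have : [set z : set_type A | set_val z = c] (SigSub (mem_set Ac)) by [].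
  by rewrite -UE.
have : (set_val @^-1` U) (SigSub (mem_set Ax) : set_type A) by [].
by rewrite UE.
Qed.

(** Compactness of the square, and not only of [S], makes [x] and [y] cluster
    along the same indices: this is what puts [x n] and [y m] with [n <> m] near
    [a] and [b], where [a * b] is the limit [c] of the constant sequence
    [x n * y n]. *)
Lemma not_countably_compact_inverse_sequences (S : topologicalSemigroupType)
    (c : S) (U : set S) (x y : nat -> S) :
  hausdorff_space S -> nbhs c U -> (forall n, x n * y n = c)%g ->
  (forall n m, U (x n * y m)%g -> n = m) ->
  ~ countably_compact [set: S * S].
Proof.
move=> hS cU xyc xyU.
move=> /(@countably_compact_cluster _ (fun n => (x n, y n)))[[a b] clab].
have often (V : set (S * S)) N :
    nbhs (a, b) V -> exists2 n, (N <= n)%N & V (x n, y n).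
  move=> abV.
  have tailN : ((fun n => (x n, y n)) @ \oo)
      ((fun n => (x n, y n)) @` [set k | (N <= k)%N]).
    by exists N => // k /= Nk; exists k.
  by have [_ [[n Nn <-] Vn]] := clab _ V tailN abV; exists n.
have mul_ab (A : set S) : nbhs (a * b)%g A ->
    nbhs (a, b) [set p : S * S | A (p.1 * p.2)%g].
  by move=> abA; exact: (@mulg_continuous S (a, b) A abA).
have abc : (a * b)%g = c.
  apply: hS => A B abA cB.
  have [n _ /=] := often _ 0%N (mul_ab _ abA).
  by rewrite xyc => Ac; exists c; split=> //; exact: nbhs_singleton.
have abU : nbhs (a * b)%g U by rewrite abc.
have [[V W] /= [aV bW] VWU] := mul_ab _ abU.
have abVW : nbhs (a, b) (V `*` W) by exists (V, W).
have [n _ [/= Vn _]] := often _ 0%N abVW.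
have [m nm [/= _ Wm]] := often _ n.+1 abVW.
have /xyU nE : U (x n * y m)%g by exact: (VWU (x n, y m)).
by rewrite nE ltnn in nm.
Qed.

Lemma translation_isometry (k : int) :
  cofinite_isometry (fun x => Some (x + k)%R).
Proof.
have full (A : set int) : (forall x, A x) -> cofinite_set A.
  move=> AT; rewrite (_ : ~` A = set0) //.
  by apply/seteqP; split=> // x /(_ (AT x)).
split.
- by apply: full => x; exists (x + k)%R.
- by apply: full => x; exists (x - k)%R; rewrite subrK.
- by move=> x y _ _ [<-] [<-]; rewrite opprD addrACA subrr addr0.
Qed.

Definition translation (k : int) : ID_infty :=
  IDInfty (asboolT (translation_isometry k)).

Lemma translationM (k l : int) :
  (translation k * translation l)%g = translation (k + l)%R.
Proof. by apply: val_inj; apply/funext => x /=; rewrite /pcomp /= addrA. Qed.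

Lemma translation_inj : injective translation.
Proof. by move=> k l /(congr1 (fun a => ID_val a 0%R)) [] /addrI. Qed.

Theorem mainTheorem7 (S : topologicalSemigroupType) :
  hausdorff_space S -> contains_discrete ID_infty S ->
  ~ countably_compact [set: S * S].
Proof.
move=> hS [f [f_inj dS]].
have [|U cU UE] := discrete_subspace_nbhs _ _ (f (translation 0%R)) dS.
  by exists (translation 0%R).
apply: (not_countably_compact_inverse_sequences S _ _
  (fun n => f (translation n%:Z)) (fun n => f (translation (- n%:Z)%R))
  hS cU) => [n|n m].
  by rewrite -gmulfM translationM subrr.
rewrite -gmulfM translationM => /UE nm.
have /f_inj/translation_inj/eqP :
    f (translation (n%:Z - m%:Z)%R) = f (translation 0%R).
  by apply: nm; exists (translation (n%:Z - m%:Z)%R).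
by rewrite subr_eq0 => /eqP[].
Qed.
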